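(* Let $I\subsetneq S$ be a monomial ideal and let $\mathfrak{S}$ be a Stanley decomposition for $S/I$ obtained by applying the recursive splitting algorithm (described in the context) to $I$. If the pairs of $\mathfrak{S}$ are given the order induced by a depth-first search (starting with left-hand children) of the associated binary tree, then $\mathfrak{S}$ is a Stanley filtration.
   Context: $S=\Bbbk[x_1,\dots,x_n]$ is a polynomial ring over a field $\Bbbk$ and $[n]=\{1,\dots,n\}$. A pair $(\mathbf{x}^{\mathbf{u}},\sigma)$, with $\mathbf{x}^{\mathbf u}$ a monomial of $S$ and $\sigma\subseteq[n]$, denotes the set of monomials $\mathbf{x}^{\mathbf{u}+\mathbf{v}}$ with $\{i:v_i\ne0\}\subseteq\sigma$. A Stanley decomposition for $S/I$ ($I$ a monomial ideal) is a finite set of pairs such that the monomials of $S$ not in $I$ are the disjoint union of the sets $(\mathbf{x}^{\mathbf{u}},\sigma)$ in it. A Stanley filtration for $S/I$ is a Stanley decomposition with an ordering $\{(\mathbf{x}^{\mathbf{u}_i},\sigma_i):1\le i\le m\}$ such that for all $1\le j\le m$ the set $\{(\mathbf{x}^{\mathbf{u}_i},\sigma_i):1\le i\le j\}$ is a Stanley decomposition for $S/(I+\langle\mathbf{x}^{\mathbf{u}_{j+1}},\dots,\mathbf{x}^{\mathbf{u}_m}\rangle)$. Recursive splitting algorithm. Input: a monomial ideal $I\neq S$. Output: a Stanley decomposition for $S/I$, computed as follows. (1) If $I$ is prime (i.e. generated by a subset of the variables), output $\{(1,\sigma)\}$ where $\sigma$ is the set of indices of variables not in $I$. (2) Otherwise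 choose (arbitrarily) a variable $x_\ell$ that is a proper divisor of a minimal generator of $I$. (3) Recursively compute a Stanley decomposition $\{(\mathbf{x}^{\mathbf{u}},\tau)\}$ for $S/(I+\langle x_\ell\rangle)$ and a Stanley decomposition $\{(\mathbf{x}^{\mathbf{v}},\sigma)\}$ for $S/(I:x_\ell)$, and output $\{(\mathbf{x}^{\mathbf{u}},\tau)\}\cup\{(\mathbf{x}^{\mathbf{v}}x_\ell,\sigma)\}$. Associated binary tree. A run of the algorithm gives a rooted binary tree whose nodes are monomial ideals, with root $I$. At a non-prime node $J$ with chosen variable $x_\ell$, the left-hand child is $J+\langle x_\ell\rangle$ (branch labeled $1$) and the right-hand child is $(J:x_\ell)$ (branch labeled $x_\ell$). Leaves are prime ideals; a leaf corresponds to the pair $(\mathbf{x}^{\mathbf{u}},\sigma)$ where $\mathbf{x}^{\mathbf{u}}$ is the product of the labels on the path from the root to the leaf and $\sigma$ is the set of indices of variables not in the leaf ideal. The depth-first search order lists, at each node, all leaves descending from the left-hand child before all leaves descending from the right-hand child. *)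

(* Defs.v *)
From HB Require Import structures.
From mathcomp Require Import all_boot all_order all_algebra.
From mathcomp Require Import boolp.
From mathcomp Require Import ring_quotient mpoly.

Set Implicit Arguments.
Unset Strict Implicit.
Unset Printing Implicit Defensive.

Import GRing.Theory.
Local Open Scope ring_scope.

(* A monomial x^u is represented by its exponent vector u : 'X_{1..n}, the
   corresponding polynomial being 'X_[u]; the order (u <= v)%MM is
   componentwise, i.e. divisibility of monomials. *)

Section Ideals.
Variables (n : nat) (k : fieldType).
Local Notation S := {mpoly k[n]}.
Local Notation mon := ('X_{1..n}).

Definition ideal_of_monomials (A : {pred mon}) : {pred S} :=
  [pred p : S | `[< exists s : seq (S * mon),
      (forall c, c \in s -> c.2 \in A) /\ p = \sum_(c <- s) c.1 * 'X_[c.2] >]].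

Definition monomial_ideal (I : {pred S}) : Prop :=
  exists A : {pred mon}, I =i ideal_of_monomials A.

Definition ideal_add (I J : {pred S}) : {pred S} :=
  [pred p : S | `[< exists a b : S, [/\ a \in I, b \in J & p = a + b] >]].

Definition ideal_colon (I : {pred S}) (f : S) : {pred S} :=
  [pred p : S | p * f \in I].

(* idealr_closed includes 1 \notin I. *)
Definition prime_ideal (I : {pred S}) : Prop :=
  idealr_closed I /\ prime_idealr_closed I.

Definition minimal_generator (I : {pred S}) (u : mon) : Prop :=
  'X_[u] \in I /\ forall v : mon, 'X_[v] \in I -> (v <= u)%MM -> v = u.

Definition proper_divisor (u v : mon) : Prop := (u <= v)%MM /\ u <> v.

End Ideals.

Section Stanley.
Variables (n : nat) (k : fieldType).
Local Notation S := {mpoly k[n]}.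
Local Notation mon := ('X_{1..n}).

Definition stanley_pair : Type := (mon * {set 'I_n})%type.

Definition in_pair (p : stanley_pair) (m : mon) : Prop :=
  exists2 v : mon, m = (p.1 + v)%MM & forall i, v i != 0%N -> i \in p.2.

Definition stanley_decomposition (I : {pred S}) (D : seq stanley_pair) : Prop :=
  [/\ uniq D,
      (forall m : mon, 'X_[m] \notin I <-> exists2 p, p \in D & in_pair p m)
    & forall p q m, p \in D -> q \in D -> in_pair p m -> in_pair q m -> p = q].

Definition stanley_filtration (I : {pred S}) (D : seq stanley_pair) : Prop :=
  stanley_decomposition I D /\
  forall j, (1 <= j <= size D)%N ->
    stanley_decomposition
      (ideal_add I (ideal_of_monomials [pred u | u \in [seq p.1 | p <- drop j D]]))
      (take j D).

End Stanley.

Section Splitting.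
Variables (n : nat) (k : fieldType).
Local Notation S := {mpoly k[n]}.
Local Notation mon := ('X_{1..n}).

Definition left_child (J : {pred S}) (l : 'I_n) : {pred S} :=
  ideal_add J (ideal_of_monomials (pred1 U_(l)%MM)).

Definition right_child (J : {pred S}) (l : 'I_n) : {pred S} :=
  ideal_colon J 'X_l.

(* An inhabitant of [splitting_tree J] is a (finite) run of the algorithm on J,
   with all its choices of variables; the subtrees are indexed by the ideals at
   the corresponding nodes. *)
Inductive splitting_tree (J : {pred S}) : Type :=
| PrimeLeaf of prime_ideal J
| Split (l : 'I_n) of
    ~ prime_ideal J &
    (exists2 u : mon, minimal_generator J u & proper_divisor U_(l)%MM u) &
    splitting_tree (left_child J l) &
    splitting_tree (right_child J l).

Definition free_variables (J : {pred S}) : {set 'I_n} :=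
  [set i | 'X_i \notin J].

Fixpoint splitting_output (J : {pred S}) (t : splitting_tree J) :
    seq (stanley_pair n) :=
  match t with
  | PrimeLeaf _ => [:: (0%MM, free_variables J)]
  | Split l _ _ t1 t2 =>
      splitting_output t1 ++
      [seq ((p.1 + U_(l))%MM, p.2) | p <- splitting_output t2]
  end.

(* The accumulator u is the product of the branch labels met so far. *)
Fixpoint dfs_pairs_from (u : mon) (J : {pred S}) (t : splitting_tree J) :
    seq (stanley_pair n) :=
  match t with
  | PrimeLeaf _ => [:: (u, free_variables J)]
  | Split l _ _ t1 t2 =>
      dfs_pairs_from u t1 ++ dfs_pairs_from (u + U_(l))%MM t2
  end.

Definition dfs_pairs (J : {pred S}) (t : splitting_tree J) :
    seq (stanley_pair n) :=
  dfs_pairs_from 0%MM t.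

Lemma dfs_pairs_fromE (u : mon) (J : {pred S}) (t : splitting_tree J) :
  dfs_pairs_from u t = [seq ((u + p.1)%MM, p.2) | p <- splitting_output t].
Proof.
elim: t u => {J} [J _|J l _ _ t1 IH1 t2 IH2] u /=; first by rewrite addm0.
rewrite IH1 IH2 map_cat -map_comp; congr (_ ++ _).
by apply: eq_map => p /=; rewrite -addmA [(U_(l) + _)%MM]addmC.
Qed.

Lemma dfs_pairsE (J : {pred S}) (t : splitting_tree J) :
  dfs_pairs t = splitting_output t.
Proof.
rewrite /dfs_pairs dfs_pairs_fromE -[RHS]map_id.
by apply: eq_map => -[v s] /=; rewrite add0m.
Qed.

End Splitting.

(* Main.v *)
Require Import Defs.
From mathcomp Require Import all_boot all_order all_algebra.
From mathcomp Require Import boolp.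
From mathcomp Require Import ring_quotient mpoly.

(** A sequence of pairs covering the monomials outside [I] is a Stanley
filtration as soon as no monomial of a pair is divisible by the base monomial
of a later pair: disjointness follows, and adding the later base monomials to
[I] removes exactly the later pairs.  Depth-first order has this property.
Indeed, at a split along [x_l] every base monomial coming from the right child
is divisible by [x_l], while no monomial of a pair coming from the left child
is; within the right child, multiplication by [x_l] preserves the property. *)

Set Implicit Arguments.
Unset Strict Implicit.
Unset Printing Implicit Defensive.

Import GRing.Theory.
Local Open Scope ring_scope.

(** * Monomial ideals: membership, sums, colons and primes in terms of exponent vectors *)

Section MonomialIdeals.
Variables (n : nat) (k : fieldType).
Local Notation S := {mpoly k[n]}.
Local Notation mon := ('X_{1..n}).
Implicit Types (I : {pred S}) (A B : {pred mon}) (m u v : mon) (p : S).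

Lemma mem_ideal_of_monomials A p :
  p \in @ideal_of_monomials n k A <->
  forall m, m \in msupp p -> exists2 a, a \in A & (a <= m)%MM.
Proof.
rewrite inE; split=> [/asboolP[s [sA ->]] m|pA].
  move=> /msupp_sum_le /flatten_mapP[c]; rewrite mem_filter /= => cs.
  rewrite (perm_mem (msuppMX _ _)) => /mapP[m' _ ->].
  by exists c.2; [exact: sA | exact: lem_addr].
apply/asboolP.
(* On the support, [f m] is a generator dividing [m], so each term of [p] becomes a multiple of
   ['X_[f m]]; off the support, [m] itself is the default. *)
have /choice[f fA] (m : mon) :
    exists a, m \in msupp p -> a \in A /\ (a <= m)%MM.
  have [/pA[a aA am]|_] := boolP (m \in msupp p); first by exists a.
  by exists m.
exists [seq (p@_m *: 'X_[m - f m], f m) | m <- msupp p]; split.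
  by move=> _ /mapP[m mp ->]; case: (fA m mp).
rewrite big_map {1}[p]mpolyE; apply: eq_big_seq => m mp /=.
by case: (fA m mp) => _ fm; rewrite -scalerAl -mpolyXD submK.
Qed.

Lemma mpolyX_ideal_of_monomials A m :
  'X_[m] \in @ideal_of_monomials n k A <-> exists2 a, a \in A & (a <= m)%MM.
Proof.
rewrite mem_ideal_of_monomials msuppX; split=> [|mA u].
  by apply; rewrite mem_seq1.
by rewrite mem_seq1 => /eqP->.
Qed.

Lemma ideal_add_monomials I A B : I =i @ideal_of_monomials n k A ->
  ideal_add I (@ideal_of_monomials n k B)
    =i @ideal_of_monomials n k [predU A & B].
Proof.
move=> IA p; apply/idP/idP.
  rewrite inE => /asboolP[a [b [aI bB ->]]].
  apply/mem_ideal_of_monomials => m /msuppD_le; rewrite mem_cat => /orP[].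
    rewrite IA in aI; move/mem_ideal_of_monomials: aI => /[apply] -[u uA um].
    by exists u; rewrite // inE uA.
  move/mem_ideal_of_monomials: bB => /[apply] -[u uB um].
  by exists u; rewrite // inE orbC; move: uB => /= ->.
rewrite inE => /asboolP[s [sAB ->]]; rewrite inE; apply/asboolP.
(* Terms are sorted by their generator: those outside [A] must come from [B]. *)
exists (\sum_(c <- s | c.2 \in A) c.1 * 'X_[c.2]).
exists (\sum_(c <- s | c.2 \notin A) c.1 * 'X_[c.2]).
split; last by rewrite [LHS](bigID (fun c => c.2 \in A)).
- rewrite IA inE; apply/asboolP; exists [seq c <- s | c.2 \in A].
  by rewrite big_filter; split=> // c; rewrite mem_filter => /andP[].
- rewrite inE; apply/asboolP; exists [seq c <- s | c.2 \notin A].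
  rewrite big_filter; split=> // c; rewrite mem_filter => /andP[cA /sAB].
  by rewrite !inE (negbTE cA).
Qed.

Lemma mpolyX_ideal_add I B m : monomial_ideal I ->
  'X_[m] \in ideal_add I (@ideal_of_monomials n k B) <->
  'X_[m] \in I \/ exists2 b, b \in B & (b <= m)%MM.
Proof.
move=> [A IA]; rewrite (ideal_add_monomials _ IA) IA !mpolyX_ideal_of_monomials.
split=> [[a]|[[a aA am]|[b bB bm]]].
- by rewrite inE => /orP[aA|aB] am; [left|right]; exists a.
- by exists a; rewrite // inE aA.
- by exists b; rewrite // inE orbC; move: bB => /= ->.
Qed.

Lemma monomial_ideal_add I B : monomial_ideal I ->
  monomial_ideal (ideal_add I (@ideal_of_monomials n k B)).
Proof. by case=> A IA; eexists; apply: (ideal_add_monomials _ IA). Qed.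

Lemma monomial_ideal_colon I u : monomial_ideal I ->
  monomial_ideal (ideal_colon I 'X_[u]).
Proof.
(* All monomials of the colon ideal serve as generators. Multiplication by ['X_[u]] translates the
   support by [u], so membership is tested monomial by monomial. *)
move=> [A IA]; exists (fun m => 'X_[m + u] \in I) => p.
rewrite inE IA; apply/idP/idP => /mem_ideal_of_monomials pA.
  apply/mem_ideal_of_monomials => m mp; exists m; last exact: lepm_refl.
  rewrite unfold_in IA; apply/mpolyX_ideal_of_monomials/pA.
  by rewrite (perm_mem (msuppMX _ _)) addmC map_f.
apply/mem_ideal_of_monomials => m.
rewrite (perm_mem (msuppMX _ _)) => /mapP[m' /pA[v + vm] ->].
rewrite unfold_in IA => /mpolyX_ideal_of_monomials[a aA /lepm_trans am].
exists a => //; apply: am; apply/mnm_lepP => i.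
by rewrite !mnmDE addnC leq_add2l; apply/mnm_lepP.
Qed.

Lemma mpolyX_mem_le I u v : monomial_ideal I ->
  (u <= v)%MM -> 'X_[u] \in I -> 'X_[v] \in I.
Proof.
move=> [A IA] uv; rewrite !IA => /mpolyX_ideal_of_monomials[a aA au].
by apply/mpolyX_ideal_of_monomials; exists a; last exact: lepm_trans uv.
Qed.

(** A monomial is a product of powers of variables, and primeness passes membership to a factor;
    [1 \notin I] rules out the empty product and zero exponents. *)
Lemma mpolyX_prime I m : monomial_ideal I -> prime_ideal I ->
  'X_[m] \in I <-> exists2 i, m i != 0%N & 'X_i \in I.
Proof.
move=> monI [[_ I1 _] primeI]; split=> [|[i mi]]; last first.
  by apply: mpolyX_mem_le; rewrite ?lep1mP.
rewrite mpolyXE_id.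
pose P (q : S) := q \in I -> exists2 i, m i != 0%N & 'X_i \in I.
apply: (big_ind P) => [|p q IHp IHq|i _].
- by rewrite /P (negbTE I1).
- by move=> /primeI/orP[/IHp|/IHq].
- have [->|mi] := eqVneq (m i) 0%N; first by rewrite /P expr0 (negbTE I1).
  move=> XI; exists i => //; elim: (m i) XI => [|e IHe].
    by rewrite expr0 (negbTE I1).
  by rewrite exprS => /primeI/orP[|/IHe].
Qed.

End MonomialIdeals.

(** * Separated sequences of pairs and Stanley filtrations *)

Section Separation.
Variables (n : nat) (k : fieldType).
Local Notation S := {mpoly k[n]}.
Local Notation mon := ('X_{1..n}).
Local Notation pair := (stanley_pair n).
Implicit Types (I : {pred S}) (D : seq pair) (p q : pair) (m : mon).

(** Not symmetric: [p] is the earlier pair. It is made boolean so that [pairwise] applies. *)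
Definition separated : rel pair :=
  fun p q => `[< forall m, in_pair p m -> ~~ (q.1 <= m)%MM >].

Definition covers I D : Prop :=
  forall m, 'X_[m] \notin I <-> exists2 p, p \in D & in_pair p m.

Lemma in_pair_base p : in_pair p p.1.
Proof. by exists 0%MM; [rewrite addm0 | move=> i; rewrite mnm0E]. Qed.

Lemma in_pair_le p m : in_pair p m -> (p.1 <= m)%MM.
Proof. by case=> v -> _; apply: lem_addr. Qed.

(** A pair contains its own base monomial. This makes a pairwise separated sequence free of
    duplicates. *)
Lemma separated_irr : irreflexive separated.
Proof.
move=> p; apply/negbTE/asboolP => /(_ _ (in_pair_base p)).
by rewrite lepm_refl.
Qed.

(** A common monomial would be a multiple of the later base monomial while lying in the earlier
    pair. *)
Lemma separated_disjoint D p q m : pairwise separated D ->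
  p \in D -> q \in D -> in_pair p m -> in_pair q m -> p = q.
Proof.
elim: D => //= r D IH /andP[/allP rD /IH{}IH].
have sep s : s \in D -> in_pair r m -> in_pair s m -> False.
  by move=> /rD/asboolP/[apply]/negP sm /in_pair_le.
rewrite !inE => /predU1P[->|pD] /predU1P[->|qD] // rm sm.
- by case: (sep q).
- by case: (sep p).
- exact: IH.
Qed.

Lemma separated_decomposition I D :
  pairwise separated D -> covers I D -> stanley_decomposition I D.
Proof.
move=> sepD covD; split=> //; first exact: (pairwise_uniq separated_irr).
by move=> p q m; apply: separated_disjoint.
Qed.

Lemma separated_filtration I D : monomial_ideal I ->
  pairwise separated D -> covers I D -> stanley_filtration I D.
Proof.
move=> monI sepD covD; split=> [|j _]; first exact: separated_decomposition.
move: sepD; rewrite -{1}(cat_take_drop j D) pairwise_cat.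
case/and3P=> /allrelP sep_td sep_t _; apply: separated_decomposition => // m.
split=> [/negP mI|[p pD pm]].
  (* Some pair of [D] contains [m]; were it in [drop j D], its base monomial would put ['X_[m]] in
     the enlarged ideal. *)
  have /covD[p] : 'X_[m] \notin I.
    by apply/negP => mI'; apply/mI/(mpolyX_ideal_add _ _ monI); left.
  rewrite -{1}(cat_take_drop j D) mem_cat => /orP[pD pm|pD pm].
    by exists p.
  case: mI; apply/(mpolyX_ideal_add _ _ monI); right.
  by exists p.1; [rewrite inE map_f | exact: in_pair_le].
(* Coverage excludes membership in [I]; separation across the cut at [j] excludes divisibility by a
   later base monomial. *)
apply/negP => /(mpolyX_ideal_add _ _ monI)[|[_ /mapP[q qD ->]]].
  by apply/negP/covD; exists p; rewrite // (mem_take pD).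
by apply/negP; move: (sep_td _ _ pD qD) => /asboolP; apply.
Qed.

End Separation.

(** * Coverage and separation along the splitting tree *)

Section Splitting.
Variables (n : nat) (k : fieldType).
Local Notation S := {mpoly k[n]}.
Local Notation mon := ('X_{1..n}).
Local Notation pair := (stanley_pair n).
Implicit Types (J : {pred S}) (D : seq pair) (p q : pair) (m : mon) (l : 'I_n).

Definition shift_pair l p : pair := ((p.1 + U_(l))%MM, p.2).

Lemma in_shift_pair l p m :
  in_pair (shift_pair l p) m <-> exists2 m', m = (m' + U_(l))%MM & in_pair p m'.
Proof.
split=> [[v -> vp]|[_ -> [v -> vp]]].
  by exists (p.1 + v)%MM; [rewrite /= -!addmA [(U_(l) + v)%MM]addmC | exists v].
by exists v => //=; rewrite -!addmA [(U_(l) + v)%MM]addmC.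
Qed.

Lemma separated_shift l p q :
  separated p q -> separated (shift_pair l p) (shift_pair l q).
Proof.
move/asboolP=> pq; apply/asboolP => _ /in_shift_pair[m -> /pq].
apply: contra => /mnm_lepP le; apply/mnm_lepP => i.
by have := le i; rewrite !mnmDE leq_add2r.
Qed.

Lemma mpolyX_left_child J l m : monomial_ideal J ->
  'X_[m] \notin left_child J l <-> 'X_[m] \notin J /\ m l = 0%N.
Proof.
move=> monJ; split=> [/negP mJ|[mJ ml]].
  split; first by apply/negP => mJ'; apply/mJ/(mpolyX_ideal_add _ _ monJ); left.
  apply/eqP; case: eqVneq => // ml; case: mJ.
  apply/(mpolyX_ideal_add _ _ monJ); right.
  by exists U_(l)%MM; rewrite ?inE ?lep1mP.
apply/negP => /(mpolyX_ideal_add _ _ monJ)[|[_ /eqP->]]; first exact/negP.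
by rewrite lep1mP ml.
Qed.

Lemma mpolyX_right_child J l m :
  ('X_[m] \in right_child J l) = ('X_[m + U_(l)] \in J).
Proof. by rewrite inE mpolyXD. Qed.

Lemma covers_prime J : monomial_ideal J -> prime_ideal J ->
  covers J [:: (0%MM, free_variables J)].
Proof.
move=> monJ primeJ m; split=> [/negP mJ|[p]].
  eexists; first exact: mem_head.
  exists m => [|i mi]; first by rewrite add0m.
  rewrite inE; apply/negP => iJ; apply: mJ.
  by apply/(mpolyX_prime _ monJ primeJ); exists i.
rewrite mem_seq1 => /eqP-> [v]; rewrite add0m => -> vJ.
by apply/negP => /(mpolyX_prime _ monJ primeJ)[i /vJ]; rewrite inE => /negP.
Qed.

Lemma covers_split J l D1 D2 : monomial_ideal J ->
  covers (left_child J l) D1 -> covers (right_child J l) D2 ->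
  covers J (D1 ++ [seq shift_pair l p | p <- D2]).
Proof.
move=> monJ cov1 cov2 m; split=> [mJ|[p]].
  have [ml|ml] := eqVneq (m l) 0%N.
    have /cov1[p pD pm] : 'X_[m] \notin left_child J l.
      exact/mpolyX_left_child.
    by exists p; rewrite // mem_cat pD.
  (* Subtraction of exponents is truncated; it is exact here because [m l] is nonzero. *)
  have mE : m = (m - U_(l) + U_(l))%MM by rewrite submK ?lep1mP.
  have /cov2[p pD pm] : 'X_[m - U_(l)] \notin right_child J l.
    by rewrite mpolyX_right_child -mE.
  exists (shift_pair l p); first by rewrite mem_cat map_f ?orbT.
  by apply/in_shift_pair; exists (m - U_(l))%MM.
rewrite mem_cat => /orP[pD pm|/mapP[q qD ->] /in_shift_pair[m' -> qm]].
  have /cov1/(mpolyX_left_child _ _ monJ)[] // :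
    exists2 p, p \in D1 & in_pair p m by exists p.
by rewrite -mpolyX_right_child; apply/cov2; exists q.
Qed.

Lemma separated_split J l D1 D2 : monomial_ideal J ->
  covers (left_child J l) D1 ->
  pairwise (@separated n) D1 -> pairwise (@separated n) D2 ->
  pairwise (@separated n) (D1 ++ [seq shift_pair l p | p <- D2]).
Proof.
move=> monJ cov1 sep1 sep2; rewrite pairwise_cat sep1 pairwise_map; apply/andP.
split; last by apply: sub_pairwise sep2 => p q; apply: separated_shift.
apply/allrelP => p _ pD /mapP[q _ ->]; apply/asboolP => m pm.
(* Coverage places [m] outside the left child, so [x_l] does not divide it, whereas it divides every
   shifted base monomial. *)
have /cov1/(mpolyX_left_child _ _ monJ)[_ ml] :
  exists2 p, p \in D1 & in_pair p m by exists p.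
by apply/negP => /mnm_lepP/(_ l); rewrite ml mnmDE mnm1E eqxx addn1.
Qed.

(** Both claims go through one induction, since separation at a split uses coverage of the left
    child. *)
Lemma splitting_output_separated J (t : splitting_tree J) : monomial_ideal J ->
  covers J (splitting_output t) /\ pairwise (@separated n) (splitting_output t).
Proof.
elim: t => {J} [J primeJ|J l _ _ t1 IH1 t2 IH2] monJ /=.
  by split=> //; apply: covers_prime.
have [cov1 sep1] := IH1 (monomial_ideal_add _ monJ).
have [cov2 sep2] := IH2 (monomial_ideal_colon _ monJ).
by split; [exact: covers_split | exact: (separated_split monJ cov1)].
Qed.

End Splitting.

Theorem corollary3p9 (n : nat) (k : fieldType) (I : {pred {mpoly k[n]}})
    (monI : monomial_ideal I) (properI : 1 \notin I) (t : splitting_tree I) :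
  stanley_filtration I (dfs_pairs t).
Proof.
(* The depth-first traversal lists pairs in the order in which the recursion concatenates them. *)
rewrite dfs_pairsE; have [covI sepI] := splitting_output_separated t monI.
exact: separated_filtration.
Qed.
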